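(* Let $X$ be a complete connected median space of (finite) rank $n$, and let $C$ be a closed bounded subset of $X$. Then the following are equivalent: 1. $C$ is compact. 2. For every $x_0\in C$ and every $\epsilon>0$ there exist finitely many points $x_1,\dots,x_{k_\epsilon}\in C$ such that for every $x\in C$ we have $d(x,[x_0,x_i])\le\epsilon$ for some $i\in\{1,\dots,k_\epsilon\}$. 3. For every $\epsilon>0$, every family $\mathcal H_\epsilon$ of pairwise disjoint halfspaces of $X$ that are transverse to $C$ and of depth bigger than $\epsilon$ in the convex hull of $C$ is finite.
   Context: For a metric space $(X,d)$ and $a,b\in X$, the interval is $[a,b]=\{x\in X : d(a,b)=d(a,x)+d(x,b)\}$. $(X,d)$ is a median space if for all $a,b,c\in X$ the intersection $[a,b]\cap[b,c]\cap[a,c]$ consists of exactly one point. A subset $C\subseteq X$ is convex if $[a,b]\subseteq C$ for all $a,b\in C$. The convex hull of a subset is the intersection of all convex subsets containing it. A halfspace is a convex subset whose complement is also convex. Two halfspaces $\mathfrak h_1,\mathfrak h_2$ are transverse if all four intersections $\mathfrak h_1\cap\mathfrak h_2$, $\mathfrak h_1^c\cap\mathfrak h_2$, $\mathfrak h_1\cap\mathfrak h_2^c$, $\mathfrak h_1^c\cap\mathfrak h_2^c$ are nonempty. The rank of $X$ is the maximal cardinality of a family of pairwise transverse halfspaces. A halfspace $\mathfrak h$ is transverse to a subset $C$ if $\mathfrak h\cap C\ne\emptyset$ and $\mathfrak h^c\cap C\neq\emptyset$. The depth of a subset $H\subseteq X$ in a subset $A\subseteq X$ is $\mathrm{depth}_A(H)=\sup\{d(x,H^c)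 : x\in A\}$. *)

(* Defs.v *)
From mathcomp Require Import all_boot all_order all_algebra.
From mathcomp Require Import all_classical all_reals.
From mathcomp Require Import topology ereal.

Set Implicit Arguments.
Unset Strict Implicit.
Unset Printing Implicit Defensive.

Import Order.TTheory GRing.Theory Num.Theory.

Local Open Scope classical_set_scope.
Local Open Scope ring_scope.
Local Open Scope card_scope.

Section MedianSpaces.
Context {R : realType} {X : metricType R}.
Implicit Types (a b c x y : X) (A C H : set X) (F : set (set X)).

Definition metric_interval a b : set X :=
  [set x | mdist a b = mdist a x + mdist x b].

Definition median_space : Prop :=
  forall a b c, exists m,
    metric_interval a b `&` metric_interval b c `&` metric_interval a c
      = [set m].

(* The axiom of [completeType], without its requirement of a distinguished
   point. *)
Definition complete_space : Prop :=
  forall G : set_system X, ProperFilter G -> cauchy G -> exists l : X, G --> l.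

Definition metric_bounded A : Prop :=
  exists M : R, forall x y, A x -> A y -> mdist x y <= M.

Definition median_convex A : Prop :=
  forall a b, A a -> A b -> metric_interval a b `<=` A.

Definition median_hull A : set X := smallest median_convex A.

(* [set0] and [setT] are halfspaces; they are transverse to nothing. *)
Definition halfspace H : Prop := median_convex H /\ median_convex (~` H).

Definition transverse H1 H2 : Prop :=
  [/\ H1 `&` H2 !=set0, ~` H1 `&` H2 !=set0,
      H1 `&` ~` H2 !=set0 & ~` H1 `&` ~` H2 !=set0].

(* Distinct members only, since [transverse H H] never holds. *)
Definition transverse_family F : Prop :=
  F `<=` halfspace /\
  forall H1 H2, F H1 -> F H2 -> H1 <> H2 -> transverse H1 H2.

Definition has_rank (n : nat) : Prop :=
  (exists2 F, transverse_family F & F #= `I_n) /\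
  (forall F, transverse_family F -> F #<= `I_n).

Definition transverse_to H C : Prop :=
  H `&` C !=set0 /\ ~` H `&` C !=set0.

(* Extended-real valued, so that the distance to [set0] is [+oo]. *)
Definition dist_to_set x A : \bar R :=
  ereal_inf [set (mdist x y)%:E | y in A].

Definition depth A H : \bar R :=
  ereal_sup [set dist_to_set x (~` H) | x in A].

End MedianSpaces.

Arguments median_space {R} X.
Arguments complete_space {R} X.
Arguments has_rank {R} X n.

(* Main.v *)
(* (1) => (2) is total boundedness.  (2) => (3): by a Caratheodory bound, the hull
   of the [c]-neighbourhood of a convex set lies in its [max(n,2) c]-neighbourhood,
   so a halfspace deep in the hull of [C] is deep at a point of [C]; it then meets
   some interval [[x0, x_i]], hence contains [x0] or [x_i], and disjointness leaves
   finitely many.  (3) => (1): let [F] be an ultrafilter containing [C] that is not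
   Cauchy.  Some point [p], an approximate minimiser of the limit of [d(p, x)] along
   [F], is such that the median of [p], [q], [x] is close to [p] for every [q] and
   almost every [x]; its existence uses that intervals are totally bounded.  Halfspaces
   [h x] separating deeply [x] from [p] are then, for almost all pairs, transverse or
   disjoint.  Finite rank excludes an infinite transverse sequence, so a Ramsey
   argument along [F] yields infinitely many disjoint ones. *)
Require Import Defs.
From mathcomp Require Import all_boot all_order all_algebra.
From mathcomp Require Import all_classical all_reals.
From mathcomp Require Import topology ereal.
From mathcomp Require Import lra.

Set Implicit Arguments.
Unset Strict Implicit.
Unset Printing Implicit Defensive.

Import Order.TTheory GRing.Theory Num.Theory.

Local Open Scope classical_set_scope.
Local Open Scope ring_scope.

(** * Sequences and Ramsey dichotomy along an ultrafilter *)

Lemma greedy_sequence (T : choiceType) (P : set T) (Q : T -> T -> Prop) :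
  (forall s : seq T, (forall y, y \in s -> P y) ->
    exists2 x, P x & forall y, y \in s -> Q y x) ->
  exists2 u : nat -> T, forall i, P (u i) &
    forall i j, (i < j)%N -> Q (u i) (u j).
Proof.
move=> step; have [x0 _ _] : exists2 x, P x & forall y, y \in [::] -> Q y x.
  exact: step.
have /choice[g gP] (s : seq T) : exists x, (forall y, y \in s -> P y) ->
    P x /\ forall y, y \in s -> Q y x.
  have [/step[x Px Qx]|ns] := pselect (forall y, y \in s -> P y).
    by exists x.
  by exists x0.
(* [pre k] lists the first [k] terms, newest first, so the term of index [k] is [g (pre k)]. *)
pose pre := fix pre k := if k is k'.+1 then g (pre k') :: pre k' else [::].
have preP k : forall y, y \in pre k -> P y.
  elim: k => [//|k IH] y; rewrite inE => /orP[/eqP ->|/IH //].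
  exact: (gP _ IH).1.
have mem_pre i j : (i < j)%N -> g (pre i) \in pre j.
  elim: j => [//|j IH]; rewrite ltnS leq_eqVlt inE => /orP[/eqP ->|/IH ->].
    by rewrite eqxx.
  by rewrite orbT.
exists (fun k => g (pre k)) => [k|i j ij]; first exact: (gP _ (preP k)).1.
by apply: (gP _ (preP j)).2; exact: mem_pre.
Qed.

Section Ultrafilter.
Context {T : choiceType} (F : set_system T) (FU : UltraFilter F).

Lemma ultra_setC (A : set T) : ~ F A -> F (~` A).
Proof. by move=> nFA; have [] := in_ultra_setVsetC A FU. Qed.

(** The finitely many conditions imposed by earlier terms all hold on sets of [F], hence hold
    together at some point; the greedy choice never stops. *)
Lemma ultra_sequence (Q : T -> T -> Prop) :
  (\forall x \near F, \forall y \near F, Q x y) ->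
  exists u : nat -> T, forall i j, (i < j)%N -> Q (u i) (u j).
Proof.
move=> FQ; pose P := [set x | \forall y \near F, Q x y].
have [s sP|u _ Qu] := @greedy_sequence T P Q; last by exists u.
suff /filter_ex[x [Px Qx]] : F [set x | P x /\ forall y, y \in s -> Q y x].
  by exists x.
elim: s sP => [|a s IH] sP.
  by apply: filterS FQ => x Px; split.
have FI : F (Q a `&` [set x | P x /\ forall y, y \in s -> Q y x]).
  apply: filterI; first by apply: sP; rewrite mem_head.
  by apply: IH => y ys; apply: sP; rewrite inE ys orbT.
apply: filterS FI => x [Qa [Px Qs]]; split=> // y.
by rewrite inE => /orP[/eqP ->|/Qs].
Qed.

(** Ramsey's theorem for pairs, read through [F]: the ultrafilter decides the colour of almost every
    pair. *)
Lemma ultra_ramsey (Q : T -> T -> Prop) :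
  (\forall x \near F, \forall y \near F, Q x y) \/
  (\forall x \near F, \forall y \near F, ~ Q x y).
Proof.
have [FQ|FQ] := pselect (\forall x \near F, \forall y \near F, Q x y).
  by left.
right; apply: filterS (ultra_setC FQ) => x /=.
exact: ultra_setC.
Qed.

End Ultrafilter.

Lemma ultra_fmap (T U : Type) (f : T -> U) (F : set_system T) :
  UltraFilter F -> UltraFilter (f @ F).
Proof.
move=> FU; split=> [|G GF sub]; first exact: fmap_proper_filter.
apply/seteqP; split=> // A GA.
have [//|FA'] := in_ultra_setVsetC (f @^-1` A) FU.
have GA' : G (~` A) by apply: sub.
by have [x []] := filter_ex (filterI GA GA').
Qed.

(** * Betweenness in a metric space *)

Section MetricInterval.
Context {R : realType} {X : metricType R}.
Implicit Types a b c d x y z : X.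

Notation "d( x , y )" := (@mdist R X x y) (format "d( x ,  y )").
Notation itv := (@metric_interval R X).

Lemma mem_interval a b x : itv a b x <-> d(a, b) = d(a, x) + d(x, b).
Proof. by []. Qed.

Lemma interval_left a b : itv a b a.
Proof. by rewrite mem_interval mdistxx add0r. Qed.

Lemma interval_right a b : itv a b b.
Proof. by rewrite mem_interval mdistxx addr0. Qed.

Lemma interval_sym a b x : itv a b x -> itv b a x.
Proof. by rewrite !mem_interval ![d(b, _)]metric_sym [d(x, a)]metric_sym addrC. Qed.

Lemma interval_refl a x : itv a a x -> x = a.
Proof.
rewrite mem_interval mdistxx [d(x, a)]metric_sym => h.
by apply/esym/mdist_positivity; have := mdist_ge0 a x; lra.
Qed.

Lemma interval_trans a b x y : itv a b x -> itv a x y -> itv a b y.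
Proof.
rewrite !mem_interval => hx hy.
by have := metric_triangle a y b; have := metric_triangle y x b; lra.
Qed.

Lemma interval_transr a b x y : itv a b x -> itv x b y -> itv a b y.
Proof.
by move=> /interval_sym hx /interval_sym hy; apply/interval_sym/(interval_trans hx).
Qed.

Lemma interval_between a b x y : itv a b x -> itv a x y -> itv y b x.
Proof.
rewrite !mem_interval => hx hy.
by have := metric_triangle a y b; have := metric_triangle y x b; lra.
Qed.

Lemma interval_antisym a x y : itv a x y -> itv a y x -> x = y.
Proof.
rewrite !mem_interval [d(y, x)]metric_sym => hx hy; apply: mdist_positivity.
by have := mdist_ge0 x y; lra.
Qed.

End MetricInterval.

(** * Medians and projection onto intervals *)

Section Median.
Context {R : realType} {X : metricType R} (medX : median_space X).
Implicit Types a b c d x y z : X.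
Implicit Types A B H : set X.

Notation "d( x , y )" := (@mdist R X x y) (format "d( x ,  y )").
Notation itv := (@metric_interval R X).

Definition median a b c : X := sval (cid (medX a b c)).
Notation m := median.

Lemma median_set a b c : itv a b `&` itv b c `&` itv a c = [set m a b c].
Proof. exact: (svalP (cid (medX a b c))). Qed.

Lemma median12 a b c : itv a b (m a b c).
Proof.
by have : [set m a b c] (m a b c) by []; rewrite -median_set => -[[]].
Qed.

Lemma median23 a b c : itv b c (m a b c).
Proof.
by have : [set m a b c] (m a b c) by []; rewrite -median_set => -[[]].
Qed.

Lemma median13 a b c : itv a c (m a b c).
Proof.
by have : [set m a b c] (m a b c) by []; rewrite -median_set => -[].
Qed.

Lemma median_unique a b c x :
  itv a b x -> itv b c x -> itv a c x -> x = m a b c.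
Proof.
by move=> ab bc ac; have : [set m a b c] x by rewrite -median_set.
Qed.

Lemma medianC a b c : m a b c = m b a c.
Proof.
by apply: median_unique; [apply/interval_sym/median12|exact: median13
  |exact: median23].
Qed.

Lemma medianAC a b c : m a b c = m a c b.
Proof.
by apply: median_unique; [exact: median13|apply/interval_sym/median23
  |exact: median12].
Qed.

Lemma median_id a b x : itv a b x -> m a b x = x.
Proof.
by move=> abx; apply/esym/median_unique => //; apply: interval_right.
Qed.

(* [m z u v] lies in the three intervals defining [m a b z]. *)
Lemma median_gate a b z x : itv a b x -> itv z x (m a b z).
Proof.
move=> abx; pose u := m z a x; pose v := m z b x; pose w := m z u v.
have au : itv a x u by exact: median23.
have bv : itv b x v by exact: median23.
have xv : itv x b v by exact: interval_sym.
have abu : itv a b u by exact: interval_trans au.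
have ubx : itv u b x by exact: interval_between au.
have ubv : itv u b v by exact: interval_transr xv.
have wuv : itv u v w by exact: median23.
have ubw : itv u b w by exact: interval_trans wuv.
have abw : itv a b w by exact: interval_transr ubw.
have zau : itv z a u by exact: median12.
have zbv : itv z b v by exact: median12.
have zaw : itv z a w by apply: (interval_trans zau); exact: median12.
have zbw : itv z b w by apply: (interval_trans zbv); exact: median13.
rewrite -(median_unique abw (interval_sym zbw) (interval_sym zaw)).
apply: (@interval_trans _ _ _ _ u); first exact: median13.
exact: median12.
Qed.

(** Both [x] and [y] reach [z] through its gate [g], so a detour to [z] costs [2 d(z, g)] more than
    stopping at [g]; betweenness forces [z = g]. *)
Lemma interval_convex a b : median_convex (itv a b).
Proof.
move=> x y abx aby z xyz.
have gx := median_gate z abx; have gy := median_gate z aby.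
suff -> : z = m a b z by exact: median12.
move: gx gy xyz; set g := m a b z; rewrite !mem_interval => gx gy xyz.
apply: mdist_positivity; have := mdist_ge0 z g.
have := metric_triangle x g y; rewrite [d(x, g)]metric_sym.
by move: xyz; rewrite [d(x, z)]metric_sym; lra.
Qed.

Lemma median_lipschitz a b x y : d(m a b x, m a b y) <= d(x, y).
Proof.
have := median_gate x (median12 a b y); have := median_gate y (median12 a b x).
set g := m a b x; set g' := m a b y; rewrite !mem_interval => hy hx.
have := metric_triangle x y g'; have := metric_triangle y x g.
by move: hx hy; rewrite [d(g', g)]metric_sym [d(y, x)]metric_sym; lra.
Qed.

Lemma median_lipschitz2 p a b x y :
  d(m a x p, m b y p) <= d(a, b) + d(x, y).
Proof.
apply: (le_trans (metric_triangle _ (m b x p) _)); apply: lerD.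
  rewrite -![m _ x p]medianAC -![m _ p x]medianC.
  by rewrite ![m p _ x]medianAC median_lipschitz.
by rewrite ![m b _ p]medianAC median_lipschitz.
Qed.

(** Projecting onto [[a, b]] preserves betweenness. The median [t] of the three projections lies
    between [z] and [g], while [g], the gate of [z], lies between [z] and [t]; hence [g = t]. *)
Lemma median_interval a b x y z :
  itv x y z -> itv (m a b x) (m a b y) (m a b z).
Proof.
move=> xyz; set gx := m a b x; set gy := m a b y; set g := m a b z.
pose t := m gx gy g; pose k := m x y t.
have abt : itv a b t.
  by apply: (interval_convex (median12 a b x) (median12 a b y)); exact: median12.
have xgt : itv x g t.
  have xgg : itv x g gx by apply: median_gate; exact: median12.
  apply: (interval_transr xgg); exact: median13.
have ygt : itv y g t.
  have ygg : itv y g gy by apply: median_gate; exact: median12.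
  apply: (interval_transr ygg); exact: median23.
have xtk : itv x t k by exact: median13.
have ytk : itv y t k by exact: median23.
have kE : k = m x y g.
  apply: median_unique; first exact: median12.
    exact: interval_trans ytk.
  exact: interval_trans xgt xtk.
have kgt : itv k g t by exact: interval_between xtk.
have gzk : itv g z k by rewrite kE; exact: median_gate.
have gzt : itv g z t by apply: (interval_trans gzk); exact: interval_sym.
have ztg : itv z t g by exact: median_gate.
suff -> : g = t by exact: median12.
apply: (@interval_antisym _ _ z) => //.
exact: interval_sym.
Qed.

Lemma median_convex_mem A a b c :
  median_convex A -> A a -> A b -> A (m a b c).
Proof. by move=> cA Aa Ab; apply: (cA a b) => //; exact: median12. Qed.

(* Projecting onto the interval [v, w] is how identities [v = w] are proved below:
   the projection acts as a halfspace separating [v] from [w] would. *)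
Lemma median_extreme v w x t u :
  itv x t u -> m v w u = v -> m v w t = w -> m v w x = v.
Proof.
move=> xtu eu et; have := median_interval v w xtu; rewrite eu et.
move=> /interval_sym h; apply/esym/(interval_antisym (a := w)); last exact: h.
exact/interval_sym/median12.
Qed.

(** * Separation of convex sets by halfspaces *)

Lemma median_extreml v w x y : m v w (m x y w) = v ->
  m v w x = v /\ m v w y = v.
Proof.
move=> e; have ww : m v w w = w by exact/median_id/interval_right.
split; first exact: (median_extreme (median13 x y w) e ww).
exact: (median_extreme (median23 x y w) e ww).
Qed.

(** Projection onto [[g, z]] sends [q] and [x] to [g], then successively [a1], [a2], [x1], [x2] and
    [z]; so [z = g]. *)
Lemma join_interval a1 a2 x x1 x2 z :
  itv a1 x x1 -> itv a2 x x2 -> itv x1 x2 z -> itv (m a1 a2 z) x z.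
Proof.
move=> h1 h2 hz; pose q := m a1 a2 z; pose g := m q x z.
have gq : m g z q = g.
  rewrite medianC [m z g q]medianAC; apply: median_id; exact/interval_sym/median13.
have gx : m g z x = g.
  rewrite medianC [m z g x]medianAC; apply: median_id; exact/interval_sym/median23.
have [g1 g2] := median_extreml gq.
have p1 : m g z x1 = g.
  by have := median_interval g z h1; rewrite g1 gx => /interval_refl.
have p2 : m g z x2 = g.
  by have := median_interval g z h2; rewrite g2 gx => /interval_refl.
have := median_interval g z hz; rewrite p1 p2 (median_id (interval_right _ _)).
move=> /interval_refl zg; have : itv q x g by exact: median12.
by rewrite -zg.
Qed.

(** Under projection onto [[w, v]], the points [a], [a1], [z] go to [w], which pushes [b], [b1],
    [x], [y] to [v]; as [z] is between [x] and [y], it goes to [v] too, and [v = w]. *)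
Lemma interval3_meet a a1 b b1 x y z (v := m b b1 z) :
  itv a x b -> itv a1 y b1 -> itv x y z -> m (m a a1 v) z v = v.
Proof.
move=> axb ayb xyz; set w := m (m a a1 v) z v.
have wvw : m w v w = w by apply: median_id; exact: interval_left.
have wvv : m w v v = v by apply: median_id; exact: interval_right.
have [/median_extreml[wa wa1] wz] := median_extreml wvw.
rewrite medianC in wvw; rewrite medianC in wvv.
have vb : m v w b = v.
  by apply: median_extreme (median13 b b1 z) _ _; rewrite // medianC.
have vb1 : m v w b1 = v.
  by apply: median_extreme (median23 b b1 z) _ _; rewrite // medianC.
have vx : m v w x = v.
  by apply: median_extreme (interval_sym axb) _ _; rewrite // medianC.
have vy : m v w y = v.
  by apply: median_extreme (interval_sym ayb) _ _; rewrite // medianC.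
have := median_interval v w xyz.
by rewrite vx vy medianC wz => /interval_refl.
Qed.

Lemma join_convex A x :
  median_convex A -> median_convex (\bigcup_(a in A) itv a x).
Proof.
move=> cA x1 x2 [a1 Aa1 ax1] [a2 Aa2 ax2] z xz.
by exists (m a1 a2 z); [exact: median_convex_mem|exact: join_interval xz].
Qed.

Lemma maximal_convex A B :
  median_convex A -> A `<=` ~` B -> exists H,
  [/\ median_convex H, A `<=` H, H `<=` ~` B &
      forall H', median_convex H' -> H `<=` H' -> H' `<=` ~` B -> H' `<=` H].
Proof.
move=> cA AB.
(* Zorn is applied to the added part [D] only, so that the empty union of the empty chain is
   admissible. *)
pose P : set (set X) := [set D | median_convex (A `|` D) /\ D `<=` ~` B].
have [|D [[cD DB] maxD]] := @Zorn_bigcup X P.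
  move=> F FP totF; split; last by move=> x [D FD]; apply: (FP D FD).2.
  have sub D : F D -> A `|` D `<=` A `|` \bigcup_(E in F) E.
    by move=> FD x [Ax|Dx]; [left|right; exists D].
  move=> x y [Ax|[D FD Dx]] [Ay|[E FE Ey]] z xyz.
  - by left; exact: cA xyz.
  - by apply: (sub E) => //; apply: (FP E FE).1 xyz; [left|right].
  - by apply: (sub D) => //; apply: (FP D FD).1 xyz; [right|left].
  - have [DE|ED] := totF D E FD FE.
      by apply: (sub E) => //; apply: (FP E FE).1 xyz; right => //; exact: DE.
    by apply: (sub D) => //; apply: (FP D FD).1 xyz; right => //; exact: ED.
exists (A `|` D); split => //; first by move=> x [/AB|/DB].
move=> H cH sH HB x Hx; right; apply: contrapT => Dx.
apply: (maxD H); first by split=> [y Dy|/(_ x Hx)//]; apply: sH; right.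
split=> //; suff -> : A `|` H = H by [].
by apply/setUidPr => y Ay; apply: sH; left.
Qed.

Lemma halfspace_separation A B :
  median_convex A -> median_convex B -> A `<=` ~` B ->
  exists H, [/\ halfspace H, A `<=` H & B `<=` ~` H].
Proof.
move=> cA cB AB.
have [A0|/set0P[a0 Aa0]] := eqVneq A set0.
  exists set0; rewrite A0; split; [|exact: subset_refl|by move=> x _].
  by split=> [x y []|x y _ _ z _ []].
have [H [cH AH HB maxH]] := maximal_convex cA AB.
exists H; split => //; last by move=> x Bx /HB.
(* Otherwise the join of [H] with [x] would be a larger convex set avoiding [B]. *)
have hit x : ~ H x -> exists a b, [/\ H a, itv a x b & B b].
  move=> Hx; apply: contrapT => nex.
  apply: Hx; apply: (maxH _ (join_convex (x := x) cH)).
  - by move=> a Ha; exists a => //; exact: interval_left.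
  - by move=> b [a Ha axb] Bb; apply: nex; exists a, b.
  - by exists a0; [exact: AH|exact: interval_right].
split=> // x y /hit[a [b [Ha axb Bb]]] /hit[a1 [b1 [Ha1 ayb Bb1]]] z xyz Hz.
(* If [z] were in [H], the point [v] would be in [B] as a median of [b], [b1], [z], and in [H] as a
   median of points of [H]. *)
have := interval3_meet axb ayb xyz; set v := m b b1 z => ev.
have Bv : B v by exact: (median_convex_mem z cB).
apply: (HB v _ Bv).
by rewrite -ev; do 2!apply: (median_convex_mem _ cH) => //.
Qed.

(** * Finite rank: Caratheodory bound and hulls of neighbourhoods *)

Section FiniteRank.
Context (n : nat) (rankX : has_rank X n).

Lemma transverse_sym H1 H2 : transverse H1 H2 -> transverse H2 H1.
Proof. by case=> i1 i2 i3 i4; split; rewrite setIC. Qed.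

Lemma transverse_bound N (h : nat -> set X) :
  (forall i, (i < N)%N -> halfspace (h i)) ->
  (forall i j, (i < j < N)%N -> transverse (h i) (h j)) -> (N <= n)%N.
Proof.
move=> hsp tr.
have trN i j : (i < N)%N -> (j < N)%N -> i <> j -> transverse (h i) (h j).
  move=> iN jN /eqP; rewrite neq_ltn => /orP[ij|ji].
    by apply: tr; rewrite ij.
  by apply/transverse_sym/tr; rewrite ji.
have hI : {in `I_N &, injective h}.
  move=> i j; rewrite !inE /= => iN jN hij; apply: contrapT.
  by move=> /(trN _ _ iN jN)[_ _]; rewrite hij => -[x []].
case: rankX => _ rk; rewrite -card_le_II.
rewrite -(card_le_eql (inj_card_eq hI)); apply: rk; split.
  by move=> _ [i iN <-]; exact: hsp.
move=> _ _ [i iN <-] [j jN <-] hij; apply: trN => // ij.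
by apply: hij; rewrite ij.
Qed.

Lemma median_hull_convex A : median_convex (median_hull A).
Proof.
move=> x y Ax Ay z xyz B [cB AB].
by apply: (cB x y) => //; [apply: Ax|apply: Ay].
Qed.

Lemma median_hull_sub A B : median_convex B -> A `<=` B -> median_hull A `<=` B.
Proof. by move=> cB AB; exact: smallest_sub. Qed.

Lemma mem_median_hull A : A `<=` median_hull A.
Proof. exact: sub_gen_smallest. Qed.

Lemma median_hullS A B : A `<=` B -> median_hull A `<=` median_hull B.
Proof.
move=> AB; apply: median_hull_sub; first exact: median_hull_convex.
by move=> x /AB; exact: mem_median_hull.
Qed.

Lemma convex_set1 x : median_convex [set x].
Proof. by move=> _ _ -> -> z /interval_refl. Qed.

Lemma median_hull_finite A p : median_hull A p -> exists s : seq X,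
  [/\ uniq s, {subset s <= A} & median_hull [set` s] p].
Proof.
pose D := [set p | exists s : seq X, {subset s <= A} /\ median_hull [set` s] p].
suff /[apply] : median_hull A `<=` D.
  case=> s [sA hs]; exists (undup s); split; first exact: undup_uniq.
    by move=> x; rewrite mem_undup => /sA.
  by apply: median_hullS hs => x /=; rewrite mem_undup.
apply: median_hull_sub => [x y [s [sA sx]] [t [tA ty]] z xyz|x Ax].
  exists (s ++ t); split; first by move=> u; rewrite mem_cat => /orP[/sA|/tA].
  apply: (median_hull_convex _ _ xyz).
    by apply: median_hullS sx => u /=; rewrite mem_cat => ->.
  by apply: median_hullS ty => u /=; rewrite mem_cat => ->; rewrite orbT.
exists [:: x]; split; first by move=> u; rewrite inE => /eqP ->; exact/mem_set.
by apply: mem_median_hull; rewrite /= inE.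
Qed.

(* In a minimal finite set spanning [p], each point [x] is separated from the
   others by a halfspace containing [p] and [x]; as soon as there are three
   points these halfspaces are pairwise transverse. *)
Lemma median_hull_caratheodory A p : median_hull A p -> exists s : seq X,
  [/\ (size s <= maxn n 2)%N, {subset s <= A} & median_hull [set` s] p].
Proof.
move=> /median_hull_finite[s [us sA sp]].
have [k] := ubnP (size s); elim: k => // k IH in s us sA sp *.
rewrite ltnS => sk; have [sn|ns] := leqP (size s) (maxn n 2).
  by exists s.
have [[x [xs hx]]|nx] :=
    pselect (exists x, x \in s /\ median_hull [set` rem x s] p).
  apply: (IH (rem x s)) => //; first exact: rem_uniq.
    by move=> y /mem_rem/sA.
  by rewrite size_rem // prednK //; case: (s) xs.
have /choice[h hP] x : exists H : set X, x \in s ->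
    [/\ halfspace H, H p, H x & forall y, y \in s -> y != x -> ~ H y].
  have [xs|_] := boolP (x \in s); last by exists set0.
  have pB : [set p] `<=` ~` median_hull [set` rem x s].
    by move=> _ -> ?; apply: nx; exists x.
  have [H [HH pH HB]] := halfspace_separation (@convex_set1 p)
    (@median_hull_convex [set` rem x s]) pB.
  have Hp : H p by exact: pH.
  have Hy y : y \in s -> y != x -> ~ H y.
    move=> ys yx; apply: HB; apply: mem_median_hull.
    by rewrite /= mem_rem_uniq // !inE yx.
  (* If [x] were outside [H], all of [s] would be, and so would [p], which lies in its hull. *)
  exists H => _; split=> //; apply: contrapT => Hx.
  apply: (median_hull_sub HH.2 _ sp) Hp => y /= ys Hy'.
  by have [yx|yx] := eqVneq y x; [apply: Hx; rewrite -yx|apply: (Hy y)].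
suff : (size s <= n)%N by rewrite leqNgt (leq_ltn_trans _ ns) ?leq_maxl.
apply: (@transverse_bound _ (fun i => h (nth p s i))) => [i si|i j /andP[ij js]].
  by have [] := hP _ (mem_nth p si).
have si := ltn_trans ij js.
set x := nth p s i; set y := nth p s j.
have xs : x \in s by exact: mem_nth.
have ys : y \in s by exact: mem_nth.
have xy : x != y by rewrite nth_uniq // ltn_eqF.
have [hx px xx ox] := hP x xs; have [hy py yy oy] := hP y ys.
have [z zs /andP[zx zy]] : exists2 z, z \in s & (z != x) && (z != y).
  have : (0 < size (rem y (rem x s)))%N.
    rewrite !size_rem // ?mem_rem_uniq // ?inE ?ys 1?eq_sym ?xy //.
    by rewrite -subn2 subn_gt0 (leq_ltn_trans _ ns) ?leq_maxr.
  case e : (rem y (rem x s)) => [//|z t] _; have : z \in rem y (rem x s).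
    by rewrite e mem_head.
  rewrite mem_rem_uniq ?rem_uniq // inE mem_rem_uniq // !inE.
  by case/and3P => zy zx zs; exists z; rewrite ?zx.
split; [by exists p| | |].
- by exists y; split=> //; apply: ox; rewrite // eq_sym.
- by exists x; split=> //; apply: oy.
- by exists z; split; [exact: ox|exact: oy].
Qed.

(** The fold replaces [q] by [m q a p] for each [a] in turn; a convex set containing [p] and either
    [q] or [a] contains this median. A parallel fold inside [B] loses at most [e] per step. *)
Lemma median_fold (B : set X) (e : R) p (s : seq X) :
  median_convex B ->
  (forall a, a \in s -> exists2 b, B b & d(a, b) <= e) ->
  forall q q' (c : R), B q' -> d(q, q') <= c -> exists r r',
  [/\ B r', d(r, r') <= c + e *+ size s &
      forall H, median_convex H -> H p -> ~ H r ->
        ~ H q /\ forall a, a \in s -> ~ H a].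
Proof.
move=> cB; elim: s => [|a s IH] near q q' c Bq' qq'.
  by exists q, q'; rewrite addr0.
have [a' Ba' aa'] := near a (mem_head _ _).
have nears b : b \in s -> exists2 b', B b' & d(b, b') <= e.
  by move=> bs; apply: near; rewrite inE bs orbT.
have [||r [r' [Br' rr' Hr]]] := IH nears (m q a p) (m q' a' p) (c + e).
- exact: median_convex_mem.
- by apply: (le_trans (median_lipschitz2 _ _ _ _ _)); exact: lerD.
exists r, r'; split=> //; first by rewrite mulrS addrA.
move=> H cH Hp Hr'; have [Hq Hs] := Hr H cH Hp Hr'.
split=> [Hq1|b]; first by apply/Hq/(cH q p) => //; exact: median13.
rewrite inE => /orP[/eqP ->|/Hs//] Ha.
by apply/Hq/(cH a p) => //; exact: median23.
Qed.

Lemma median_hull_near (A B : set X) (e : R) p :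
  0 <= e -> median_convex B ->
  (forall a, A a -> exists2 b, B b & d(a, b) <= e) -> median_hull A p ->
  exists2 b, B b & d(p, b) <= e *+ maxn n 2.
Proof.
move=> e0 cB near /median_hull_caratheodory[[|a s] [sn sA sp]].
  suff : median_hull [set` @nil X] `<=` set0 by move=> /(_ _ sp).
  by apply: median_hull_sub => // x y [].
have nears b : b \in a :: s -> exists2 b', B b' & d(b, b') <= e.
  by move=> /sA; rewrite inE; exact: near.
have [a' Ba' aa'] := nears a (mem_head _ _).
have {}nears b : b \in s -> exists2 b', B b' & d(b, b') <= e.
  by move=> bs; apply: nears; rewrite inE bs orbT.
have [r [r' [Br' rr' Hr]]] := median_fold p cB nears Ba' aa'.
(* A halfspace containing [p] but not [r] would miss every spanning point, hence also [p]. *)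
have rp : r = p.
  apply: contrapT => rp.
  have pr : [set p] `<=` ~` [set r] by move=> _ -> pr; exact: rp.
  have [H [[cH cH'] pH rH]] :=
    halfspace_separation (@convex_set1 p) (@convex_set1 r) pr.
  have Hp : H p by exact: pH.
  have [Ha Hs] := Hr H cH Hp (rH r erefl).
  by apply: (median_hull_sub cH' _ sp) Hp => b; rewrite /= inE => /orP[/eqP ->|/Hs].
exists r' => //; rewrite -rp (le_trans rr') // -mulrS.
by rewrite -[leLHS]mulr_natr -[leRHS]mulr_natr ler_wpM2l // ler_nat.
Qed.

Lemma halfspace_deep (e : R) : 0 < e -> exists2 c : R, 0 < c &
  forall x y, e <= d(x, y) -> exists H,
    [/\ halfspace H, ball x c `<=` H & ball y c `<=` ~` H].
Proof.
(* With this [c], the hull of a ball of radius [c] stays within [e / 3] of its centre, so the two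
   hulls are disjoint. *)
move=> e0; pose K := maxn n 2; pose c := e / (3 * K%:R).
have K0 : 0 < K%:R :> R by rewrite ltr0n (leq_trans _ (leq_maxr n 2)).
have c0 : 0 < c by rewrite divr_gt0 // mulr_gt0.
have cK : c *+ K = e / 3.
  by rewrite -[c *+ K]mulr_natr /c invfM mulrA mulfVK // gt_eqF.
exists c => // x y exy.
have near z p : median_hull (ball z c) p -> d(p, z) <= e / 3.
  rewrite -cK => hp; have [_ -> //] : exists2 b, [set z] b & d(p, b) <= c *+ K.
  apply: median_hull_near hp; [exact: ltW|exact: convex_set1|].
  by move=> a; rewrite ballEmdist /= => za; exists z; rewrite // metric_sym ltW.
have [|H [HH xH yH]] := halfspace_separation
    (@median_hull_convex (ball x c)) (@median_hull_convex (ball y c)).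
  move=> p /near px /near py; have := metric_triangle x p y.
  by rewrite [d(x, p)]metric_sym; lra.
exists H; split=> // z zc; first by apply: xH; exact: mem_median_hull.
by apply: yH; exact: mem_median_hull.
Qed.

(** * Total boundedness of intervals and approximate centres of ultrafilters *)

Lemma median_parallel a b x z : itv a b x -> itv a b z ->
  d(z, m b z x) = d(x, m a z x).
Proof.
(* The points [z], [q], [x], [p] are the successive corners of a rectangle in [[a, b]], whose
   opposite sides are equal. *)
move=> abx abz; set p := m a z x; set q := m b z x.
have zxp : itv z x p by exact: median23.
have zxq : itv z x q by exact: median23.
have azp : itv a z p by exact: median12.
have axp : itv a x p by exact: median13.
have bzq : itv b z q by exact: median12.
have bxq : itv b x q by exact: median13.
move: abx abz zxp zxq azp axp bzq bxq; rewrite !mem_interval.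
rewrite [d(p, x)]metric_sym [d(q, x)]metric_sym [d(p, z)]metric_sym.
rewrite [d(q, z)]metric_sym [d(z, b)]metric_sym [d(x, b)]metric_sym.
by lra.
Qed.

(** Moving from [z] towards [b] to [m b z (u k)] keeps outside the earlier halfspaces. The gain
    equals the distance from [u k] to a point of [[a, z]], which misses [h k], so it is at least
    [c]. *)
Lemma interval_halfspace_bound a b (c : R) (u : nat -> X) (h : nat -> set X) :
  (forall i, [/\ itv a b (u i), halfspace (h i), ball (u i) c `<=` h i &
     ~ h i a]) ->
  (forall i j, (i < j)%N -> ~ h i (u j)) ->
  forall k z, itv a b z -> (forall i, (i < k)%N -> ~ h i z) -> c *+ k <= d(b, z).
Proof.
move=> uh hu; elim=> [|k IH] z abz hz; first exact: mdist_ge0.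
have [abk [ck ck'] uk ha] := uh k.
pose z' := m b z (u k).
have abz' : itv a b z'.
  by apply: (interval_convex abz abk); exact: median23.
have hz' i : (i < k)%N -> ~ h i z'.
  move=> ik; have [_ [_ ci] _ _] := uh i.
  apply: (ci z (u k)); [by apply: hz; rewrite ltnS ltnW|exact: hu|].
  exact: median23.
have far : c <= d(z, z').
  rewrite (median_parallel abk abz) leNgt; apply/negP => lt.
  have /ck' : (~` h k) z by exact: hz.
  by move=> /(_ _ ha _ (interval_sym (median12 a z (u k)))); apply; apply: uk;
    rewrite ballEmdist.
have := IH z' abz' hz'; have : itv b z z' by exact: median12.
by rewrite mem_interval [d(z', z)]metric_sym mulrS; lra.
Qed.

Section UltrafilterOnX.
Context (F : set_system X) (FU : UltraFilter F).

(** Two exceptional points at distance at least [e] are separated by a deep halfspace, and [F]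
    contains it or its complement; one of the two is then not exceptional. *)
Lemma ultra_halfspace (e : R) : 0 < e -> (forall x, ~ F (ball x e)) ->
  exists2 c : R, 0 < c & \forall x \near F,
    exists H, [/\ halfspace H, ball x c `<=` H & F (~` H)].
Proof.
move=> e0 nF; have [c c0 deep] := halfspace_deep e0.
exists c => //; apply: contrapT => /(ultra_setC FU) bad.
have [x /= badx] := filter_ex bad.
have /(filterI bad)/filter_ex[y [/= bady ny]] := ultra_setC FU (nF x).
have /deep[H [[cH cH'] xH yH]] : e <= d(x, y).
  by rewrite leNgt; apply/negP => xy; apply: ny; rewrite ballEmdist.
have [FH|FH'] := in_ultra_setVsetC H FU; last by apply: badx; exists H.
apply: bady; exists (~` H); split; [|exact: yH|by rewrite setCK].
by split; rewrite ?setCK.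
Qed.

Lemma ultra_interval_cauchy a b (e : R) : F (itv a b) -> 0 < e ->
  exists g, F (ball g e).
Proof.
move=> Fab e0; apply: contrapT => nex.
have [c c0 Fc] : exists2 c : R, 0 < c & \forall x \near F,
    exists H, [/\ halfspace H, ball x c `<=` H & F (~` H)].
  by apply: ultra_halfspace e0 _ => x Fx; apply: nex; exists x.
pose bad p x := exists H : set X, [/\ [/\ itv a b x, halfspace H,
  ball x c `<=` H & ~ H p] & F (~` H)].
(* A halfspace containing both endpoints contains [[a, b]], a set of [F], so its complement cannot
   be in [F]. *)
have Fbad : F (bad a) \/ F (bad b).
  have [|Fa] := in_ultra_setVsetC (bad a) FU; first by left.
  right; apply: filterS (filterI (filterI Fa Fab) Fc) => x [[/= ax abx]].
  move=> [H [[cH cH'] xH FH]]; exists H; split=> //; split=> // Hb.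
  have [Ha|Ha] := pselect (H a); last by apply: ax; exists H.
  have [y [/= aby]] := filter_ex (filterI Fab FH); apply.
  exact: (cH a b).
have {Fbad Fab Fc nex e0} [p [q [Fp pq]]] : exists p q,
    F (bad p) /\ itv a b = itv p q.
  case: Fbad => Fp; [exists a, b|exists b, a]; split=> //.
  by apply/seteqP; split=> z; exact: interval_sym.
have /choice[h hP] x : exists H : set X, bad p x -> [/\ [/\ itv a b x,
    halfspace H, ball x c `<=` H & ~ H p] & F (~` H)].
  by have [[H ?]|?] := pselect (bad p x); [exists H|exists setT].
have [|u uP] := @ultra_sequence _ F FU (fun x y => bad p x /\ ~ h x y).
  apply: filterS Fp => x bx; have [_ Fh] := hP x bx.
  by apply: filterS Fh => y hy; split.
have bu i : bad p (u i) by exact: (uP i i.+1 (ltnSn i)).1.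
(* The endpoint [p] avoids every halfspace of the sequence, so [d(q, p)] exceeds all multiples of
   [c], which is absurd. *)
have dist k : c *+ k <= d(q, p).
  apply: (@interval_halfspace_bound p q c u (h \o u)).
  - by move=> i; have [[abu ? ? ?] _] := hP _ (bu i); split; rewrite // -pq.
  - by move=> i j /uP[].
  - exact: interval_left.
  - by move=> i _; have [[]] := hP _ (bu i).
have := dist (Num.bound (d(q, p) / c)); apply/negP; rewrite -ltNge.
rewrite -mulr_natl -ltr_pdivrMr //.
by apply: archi_boundP; rewrite divr_ge0 ?mdist_ge0 // ltW.
Qed.

End UltrafilterOnX.

(** The image of [F] under projection onto [[a, b]] is an ultrafilter living on that interval. *)
Lemma ultra_median_cauchy (F : set_system X) (FU : UltraFilter F) a b (e : R) :
  0 < e -> exists g, \forall x \near F, d(g, m a b x) < e.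
Proof.
move=> e0; have GU := ultra_fmap (m a b) FU.
have Gab : (m a b @ F) (itv a b).
  exact: (@filterE _ F _ _ (median12 a b)).
have [g Gg] := ultra_interval_cauchy GU Gab e0.
exists g; move: Gg; rewrite ballEmdist; exact.
Qed.

(* [p] almost minimises the limit of [d(p, x)] along [F], so that, seen from
   any [q], almost every [x] lies behind [p]. *)
Lemma ultra_median_center (F : set_system X) (FU : UltraFilter F) (e : R) :
  0 < e -> (exists p (M : R), \forall x \near F, d(p, x) <= M) ->
  exists p, forall q, \forall x \near F, d(p, m p q x) < e.
Proof.
move=> e0 [p0 [M FM]].
pose S : set R := [set s | exists p, \forall x \near F, d(p, x) <= s].
have infS : has_inf S.
  split; first by exists M, p0.
  exists 0 => s [p Fs]; have [x] := filter_ex Fs.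
  by apply: le_trans; exact: mdist_ge0.
have e40 : 0 < e / 4 by rewrite divr_gt0.
have [s [p Fs] sr] := inf_adherent e40 infS.
exists p => q; have [g Fg] := ultra_median_cauchy FU p q e40.
(* Going through the median, [g] is nearer to almost every [x] than [p] is, by about [d(p, g)]. The
   slack is one [e / 4] for the choice of [p] and two for replacing the median by [g]. *)
have pg : d(p, g) <= 3 * (e / 4).
  have : S (inf S + 3 * (e / 4) - d(p, g)).
    exists g; apply: filterS (filterI Fs Fg) => x [/= px gx].
    have := median13 p q x; rewrite mem_interval.
    have := metric_triangle g (m p q x) x.
    have := metric_triangle p (m p q x) g.
    by rewrite [d(m p q x, g)]metric_sym; lra.
  by move=> /(ge_inf infS.2); lra.
apply: filterS Fg => x gx.
by have := metric_triangle p g (m p q x); lra.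
Qed.

(** * The three implications *)

Lemma dist_to_set_lt x A (e : R) :
  (dist_to_set x A < e%:E)%E -> exists2 y, A y & d(x, y) < e.
Proof.
by move=> /ereal_inf_lt[_ [y Ay <-]]; rewrite lte_fin => xy; exists y.
Qed.

Lemma dist_to_set_le x y A : A y -> (dist_to_set x A <= (d(x, y))%:E)%E.
Proof. by move=> Ay; apply: ereal_inf_lbound; exists y. Qed.

Lemma compact_net (C : set X) (e : R) : compact C -> 0 < e ->
  exists2 s : seq X, {subset s <= C} &
    forall x, C x -> exists2 y, y \in s & d(x, y) < e.
Proof.
move=> cC e0; apply: contrapT => nex.
have [s sC|u Cu uu] := @greedy_sequence X C (fun y x => e <= d(x, y)).
  apply: contrapT => nx; apply: nex; exists s => [y /sC/mem_set //|x Cx].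
  apply: contrapT => ny; apply: nx; exists x => // y ys.
  by rewrite leNgt; apply/negP => xy; apply: ny; exists y.
have [p [Cp up]] := cC (u @ \oo) _ (filterE _ Cu).
have e20 : 0 < e / 2 by rewrite divr_gt0.
have near N : exists2 i, (N <= i)%N & d(p, u i) < e / 2.
  have [|_ [[i Ni <-]]] := up [set u i | i in [set i | N <= i]%N] _ _
    (nbhsx_ballx p (e / 2) e20).
    by exists N => // i /= Ni; exists i.
  by rewrite ballEmdist /= => pi; exists i.
have [i _ pi] := near 0%N; have [j ij pj] := near i.+1.
have := uu i j ij; have := metric_triangle (u j) p (u i).
by rewrite [d(u j, p)]metric_sym; lra.
Qed.

Lemma compact_interval_net (C : set X) : compact C ->
  forall x0 (e : R), C x0 -> 0 < e ->
  exists S : set X, [/\ finite_set S, S `<=` C &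
    forall x, C x -> exists2 y, S y & (dist_to_set x (itv x0 y) <= e%:E)%E].
Proof.
move=> cC x0 e _ e0; have [s sC sP] := compact_net cC e0.
exists [set` s]; split=> [|y /sC/set_mem //|x /sP[y ys xy]]; first exact: finite_seq.
exists y => //; apply: le_trans (dist_to_set_le _ (interval_right x0 y)) _.
by rewrite lee_fin ltW.
Qed.

Lemma interval_net_finite (C : set X) :
  (forall x0 (e : R), C x0 -> 0 < e ->
  exists S : set X, [/\ finite_set S, S `<=` C &
    forall x, C x -> exists2 y, S y & (dist_to_set x (itv x0 y) <= e%:E)%E]) ->
  forall e : R, 0 < e -> forall F : set (set X),
  (forall H, F H -> [/\ halfspace H, transverse_to H C &
    (e%:E < depth (median_hull C) H)%E]) ->
  trivIset F id -> finite_set F.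
Proof.
move=> net e e0 F FP trF.
have [->|/set0P[H0 FH0]] := eqVneq F set0; first exact: finite_set0.
have [_ [[x0 [_ Cx0]] _] _] := FP H0 FH0.
(* If no ball of radius [c] around a point of [C] lay in [H], the hull would be within
   [c *+ maxn n 2 = e] of the complement, against the depth of [H]. *)
pose c := e / (maxn n 2)%:R.
have K0 : 0 < (maxn n 2)%:R :> R by rewrite ltr0n (leq_trans _ (leq_maxr n 2)).
have c0 : 0 < c by rewrite divr_gt0.
(* Half of [c] makes the distance to the interval strictly less than [c], so that it is realised up
   to [c] by a point. *)
have [|S [finS SC SP]] := net x0 (c / 2) Cx0; first by rewrite divr_gt0.
have hit H : F H -> exists2 y, (x0 |` S) y & H y.
  move=> /FP[[cH cH'] _ /ereal_sup_gt[_ [p hp <-]] deep].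
  have [a Ca aH] : exists2 a, C a & ball a c `<=` H.
    apply: contrapT => nex; have near a : C a -> exists2 b, (~` H) b & d(a, b) <= c.
      move=> Ca; apply: contrapT => nb; apply: nex; exists a => // z.
      rewrite ballEmdist /= => az; apply: contrapT => Hz; apply: nb.
      by exists z => //; exact: ltW.
    have [b Hb pb] := median_hull_near (ltW c0) cH' near hp.
    move: deep; apply/negP; rewrite -leNgt.
    apply: le_trans (dist_to_set_le _ Hb) _; rewrite lee_fin (le_trans pb) //.
    by rewrite -[c *+ _]mulr_natr mulfVK // gt_eqF.
  have [y Sy ay] := SP a Ca.
  have [|z xyz az] := @dist_to_set_lt a (itv x0 y) c.
    by apply: le_lt_trans ay _; rewrite lte_fin; lra.
  have Hz : H z by apply: aH; rewrite ballEmdist.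
  have [Hx|Hx] := pselect (H x0); first by exists x0 => //; left.
  exists y; first by right.
  by apply: contrapT => Hy; exact: (cH' x0 y Hx Hy z xyz Hz).
(* By disjointness a point lies in at most one member of [F], which [g] selects. *)
have /choice[g gP] y : exists H : set X, forall H', F H' -> H' y -> H' = H.
  have [[H [FH Hy]]|ny] := pselect (exists H, F H /\ H y).
    by exists H => H' FH' Hy'; apply: trF => //; exists y.
  by exists set0 => H' FH' Hy; exfalso; apply: ny; exists H'.
apply: (@sub_finite_set _ _ (g @` (x0 |` S))).
  by move=> H FH; have [y Sy Hy] := hit H FH; exists y => //; exact/esym/gP.
by apply: finite_image; rewrite finite_setU; split=> //; exact: finite_set1.
Qed.

Lemma halfspace_finite_compact (C : set X) : complete_space X ->
  closed C -> metric_bounded C ->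
  (forall e : R, 0 < e -> forall F : set (set X),
  (forall H, F H -> [/\ halfspace H, transverse_to H C &
    (e%:E < depth (median_hull C) H)%E]) ->
  trivIset F id -> finite_set F) -> compact C.
Proof.
move=> complX closedC [M CM] fin; rewrite compact_ultra => F FU FC.
suff cF : cauchy F.
  have [l Fl] := complX F _ cF; exists l; split=> //.
  by apply: closedC => B lB; exact: (filter_ex (filterI FC (Fl B lB))).
apply: cauchy_exP => e e0; apply: contrapT => nex.
have nF x : ~ F (ball x e) by move=> Fx; apply: nex; exists x.
have [c c0 deep] := halfspace_deep e0.
(* The tolerance [c] puts these medians in the ball around [p] that the halfspaces [h x] avoid. *)
have [p Fp] : exists p, forall q, \forall x \near F, d(p, m p q x) < c.
  apply: (ultra_median_center FU c0).
  have [x Cx] := filter_ex FC; exists x, M.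
  by apply: filterS FC => y; exact: CM.
pose good x H := [/\ halfspace H, ball x c `<=` H & ball p c `<=` ~` H].
have /choice[h hP] x : exists H : set X, e <= d(p, x) -> good x H.
  have [ex|_] := leP e (d(p, x)); last by exists setT.
  by have [|H HP] := deep x p; [rewrite metric_sym|exists H].
pose P x := C x /\ good x (h x).
have FP : F P.
  apply: filterS (filterI FC (ultra_setC FU (nF p))) => x [Cx px].
  split=> //; apply: hP; rewrite leNgt; apply/negP => xp.
  by apply: px; rewrite ballEmdist.
pose Q x y := [/\ P x, P y & d(p, m p x y) < c].
have FQ : \forall x \near F, \forall y \near F, Q x y.
  apply: filterS (FP) => x Px; apply: filterS (filterI FP (Fp x)) => y.
  by move=> [Py pxy].
have FQ2 (Q' : X -> X -> Prop) : (\forall x \near F, \forall y \near F, Q' x y) ->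
    \forall x \near F, \forall y \near F, Q x y /\ Q' x y.
  move=> FQ'; apply: filterS (filterI FQ FQ') => x [Qx Qx'].
  exact: filterI.
have center x : P x -> ~ h x p.
  by move=> [_ [_ _ hp]]; apply: hp; rewrite ballEmdist /= mdistxx.
have own x : P x -> h x x.
  by move=> [_ [_ hx _]]; apply: hx; rewrite ballEmdist /= mdistxx.
(* If [h x] contained [y], it would contain the median of [p], [x], [y], which is too close to
   [p]. *)
have Q1 x y : Q x y -> ~ h x y.
  move=> [Px Py pxy] hy; have [_ [[cH _] _ hp]] := Px.
  apply: (hp (m p x y)); first by rewrite ballEmdist.
  by apply: (cH x y) => //; [exact: own|exact: median23].
have Q2 x y : Q x y -> ~ h y x.
  move=> [Px Py pxy] hx; have [_ [[cH _] _ hp]] := Py.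
  apply: (hp (m p x y)); first by rewrite ballEmdist.
  by apply: (cH x y) => //; [exact: own|exact: median23].
have [/FQ2|/FQ2] := ultra_ramsey FU (fun x y => transverse (h x) (h y)).
  move=> /(ultra_sequence FU)[u uP].
  suff : (n.+1 <= n)%N by rewrite ltnn.
  apply: (transverse_bound (h := h \o u)) => [i _|i j /andP[ij _]] /=.
    by have [[[_ []]]] := uP i i.+1 (ltnSn i).
  by have [] := uP i j ij.
move=> /(ultra_sequence FU)[u uP].
have Pu i : P (u i) by have [[]] := uP i i.+1 (ltnSn i).
(* The points [u i], [u j] and [p] witness three of the four quadrants, so failing transversality
   leaves only an empty intersection. *)
have disj i j : (i < j)%N -> h (u i) `&` h (u j) = set0.
  move=> ij; have [Qij nt] := uP i j ij.
  rewrite -subset0 => z [hi hj]; apply: nt; split.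
  - by exists z.
  - by exists (u j); split; [exact: Q1 Qij|exact: own].
  - by exists (u i); split; [exact: own|exact: Q2 Qij].
  - by exists p; split; exact: center.
have disj' i j : h (u i) `&` h (u j) !=set0 -> i = j.
  move=> hij; apply: contrapT => /eqP; rewrite neq_ltn => /orP[/disj|/disj] e1.
    by move: hij; rewrite e1 => -[].
  by move: hij; rewrite setIC e1 => -[].
(* Each [h (u i)] has depth at least [c]; the strict bound is obtained at [c / 2]. *)
have c20 : 0 < c / 2 by rewrite divr_gt0.
suff finF : finite_set (range (h \o u)).
  apply: infinite_nat.
  have inj : {in [set: nat] &, injective (h \o u)}.
    move=> i j _ _ /= hij; apply: disj'; rewrite -hij setIid.
    by exists (u i); exact: own.
  by rewrite -(eq_finite_set (inj_card_eq inj)).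
apply: (fin _ c20) => [_ [i _ <-]|_ _ [i _ <-] [j _ <-] /disj' -> //].
have [Cui [Hh hball _]] := Pu i; split=> //.
  split; first by exists (u i); split; [exact: own|].
  have [[_ [Cuj _] _] _] := uP i i.+1 (ltnSn i).
  by exists (u i.+1); split=> //; apply: Q1; have [] := uP i i.+1 (ltnSn i).
apply: (@lt_le_trans _ _ c%:E); first by rewrite lte_fin; lra.
apply: (@le_trans _ _ (dist_to_set (u i) (~` h (u i)))).
  apply: le_ereal_inf_tmp => _ [y hy <-]; rewrite lee_fin leNgt; apply/negP => uy.
  by apply: hy; apply: hball; rewrite ballEmdist.
by apply: ereal_sup_ubound; exists (u i) => //; exact: mem_median_hull.
Qed.

End FiniteRank.

End Median.

Theorem theorem1p3 (R : realType) (X : metricType R) (n : nat)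
  (hcomplete : complete_space X)
  (hconnected : connected [set: X])
  (hmedian : median_space X)
  (hrank : has_rank X n)
  (C : set X) (hclosed : closed C) (hbounded : metric_bounded C) :
  [<-> compact C;
       forall (x0 : X) (eps : R), C x0 -> 0 < eps ->
         exists S : set X,
           [/\ finite_set S, S `<=` C &
               forall x, C x -> exists2 y, S y &
                 (dist_to_set x (metric_interval x0 y) <= eps%:E)%E];
       forall (eps : R), 0 < eps ->
         forall F : set (set X),
           (forall H, F H ->
              [/\ halfspace H, transverse_to H C &
                  (eps%:E < depth (median_hull C) H)%E]) ->
           trivIset F id ->
           finite_set F].
Proof.
tfae.
- exact: compact_interval_net.
- exact: (interval_net_finite hmedian hrank).
- exact: (halfspace_finite_compact hmedian hrank).
Qed.
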